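(* Let $f:\mathbb{R}\to\mathbb{R}$ be a Lebesgue measurable function. If $f$ is $(S,T)$ shift continuous for some Lebesgue measurable set $S\subset\mathbb{R}$ and some (arbitrary) set $T\subset\mathbb{R}$, then $f$ is continuous (in the usual topology of $\mathbb{R}$) at every point of $\mathrm{LD}(S)+\mathrm{OD}(T)$.
   Context: Shift continuity: for sets $S,T\subset\mathbb{R}$, a function $f:\mathbb{R}\to\mathbb{R}$ is called $(S,T)$ shift continuous if there exists a second countable topology $\mathcal{T}$ on the set $T$ such that for every $s_0\in S$ the function $T\to\mathbb{R}$, $t\mapsto f(s_0+t)$, is continuous with respect to $\mathcal{T}$. (The topology $\mathcal{T}$ need not be related to the usual topology.) $\mathrm{LD}(S)$ is the set of Lebesgue density points of $S$: all $x\in\mathbb{R}$ (possibly outside $S$) with $\lim_{r\to0^+}\frac{\mathrm{mes}(S\cap(x-r,x+r))}{2r}=1$, where $\mathrm{mes}$ is Lebesgue measure. $\mathrm{OD}(T)$ is the set of outer density points of $T$: all $x\in\mathbb{R}$ (possibly outside $T$) with $\lim_{r\to0^+}\frac{\mathrm{mes}^*(T\cap(x-r,x+r))}{2r}=1$, where $\mathrm{mes}^*$ is Lebesgue outer measure. $A+B=\{a+b : a\in A,\ b\in B\}$. *)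

(* Defs.v *)
From HB Require Import structures.
From mathcomp Require Import all_boot all_order all_algebra.
From mathcomp Require Import all_classical all_reals all_analysis.
Set Implicit Arguments.
Unset Strict Implicit.
Unset Printing Implicit Defensive.
Import Order.TTheory GRing.Theory Num.Theory.
Import numFieldTopology.Exports numFieldNormedType.Exports.
Local Open Scope classical_set_scope.
Local Open Scope ring_scope.

Definition lebesgue_outer_measure (R : realType) : set R -> \bar R :=
  (@wlength R idfun)^*%mu.

(* R with the Lebesgue sigma-algebra (Caratheodory measurable sets), as opposed
   to measurableTypeR R, which carries the Borel sigma-algebra *)
Definition lebesgueTypeR (R : realType) :=
  caratheodory_type (@wlength R idfun)^*%mu.

Definition lebesgue_measurable (R : realType) (A : set R) : Prop :=
  measurable (A : set (lebesgueTypeR R)).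

(* preimages of Borel sets are Lebesgue measurable *)
Definition lebesgue_measurable_fun (R : realType) (f : R -> R) : Prop :=
  measurable_fun setT (f : lebesgueTypeR R -> measurableTypeR R).

(* tau ranges over all topologicalType structures on the bare subtype
   set_type T, so continuity below refers to tau and not to the subspace
   topology of T in R *)
Definition shift_continuous (R : realType) (S T : set R) (f : R -> R) : Prop :=
  exists tau : Topological.axioms_ (set_type T),
    let X : topologicalType := Topological.Pack tau in
    @second_countable X /\
    forall s0, S s0 -> continuous ((fun t : set_type T => f (s0 + \val t)) : X -> R).

Definition LD (R : realType) (S : set R) : set R :=
  [set x | (completed_lebesgue_measure (S `&` `](x - r)%R, (x + r)%R[) /
            (2 * r)%:E)%E @[r --> 0^'+] --> 1%:E].

Definition OD (R : realType) (T : set R) : set R :=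
  [set x | (lebesgue_outer_measure (T `&` `](x - r)%R, (x + r)%R[) /
            (2 * r)%:E)%E @[r --> 0^'+] --> 1%:E].

(* Main.v *)
Require Import Defs.
From mathcomp Require Import all_boot all_order all_algebra.
From mathcomp Require Import all_classical all_reals all_analysis.
From mathcomp Require Import measurable_realfun lra.
Set Implicit Arguments.
Unset Strict Implicit.
Unset Printing Implicit Defensive.
Import Order.TTheory GRing.Theory Num.Theory.
Import numFieldTopology.Exports numFieldNormedType.Exports.
Local Open Scope classical_set_scope.
Local Open Scope ring_scope.

(** Let (U_i) be a countable base of the topology on T, let eps > 0, and let
E_i be the set of s in S such that f(s + _) oscillates by at most eps on U_i.
A countable dense subset of T shows that E_i is Lebesgue measurable, and shift
continuity says that the products E_i x U_i cover S x T. If x = a + b with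
a in LD(S) and b in OD(T), then T and x - S meet near b in a set of positive
outer measure, so some U_i and x - E_i do as well. Translation is continuous
in measure on measurable sets, hence for all small h some t in U_i has both
s = x - t and s + h in E_i. It is also continuous in measure on measurable
functions, hence some t' in U_i has f(s + t') and f(s + t' + h) within eps of
each other. Comparing f(x) with f(s + t') and f(x + h) with f(s + h + t') then
gives |f(x) - f(x + h)| <= 3 eps. *)

Local Notation "mu^*" := ((@wlength _ idfun)^*)%mu (at level 0).

(** * Outer measure under translations and reflections *)

Section outer_measure_isometry.
Context (R : realType).
Implicit Types (A : set R) (a b c : R).

Lemma outer_measure_oo a b : a <= b -> mu^* `]a, b[ = (b - a)%:E.
Proof.
move=> ab; transitivity (@lebesgue_measure R `]a, b[) => //.
rewrite lebesgue_measure_itv/= lte_fin -EFinD; case: ltP => // ba.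
by have -> : a = b by [lra]; rewrite subrr.
Qed.

Lemma outer_measure_oo_lty a b : (mu^* `]a, b[ < +oo)%E.
Proof.
have [ab|ba] := leP a b; first by rewrite outer_measure_oo// ltry.
by rewrite set_itv_ge ?outer_measure0 -?leNgt//= bnd_simp ltW.
Qed.

(** Pulling back along [g] turns a cover of [A] by open intervals into a cover of the preimage by
    intervals of the same lengths. *)
Lemma le_outer_measure_preimage (g : R -> R) A :
  (forall a b, exists2 ab, g @^-1` `]a, b[%classic = `]ab.1, ab.2[%classic &
                           ab.2 - ab.1 = b - a) ->
  (mu^* (g @^-1` A) <= mu^* A)%E.
Proof.
move=> hg; rewrite [leRHS]outer_measure_open_itv_cover.
apply: le_ereal_inf_tmp => _ [F [Fitv AF] <-].
apply: (@le_trans _ _ (mu^* (\bigcup_k (g @^-1` F k)))).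
  by apply: le_outer_measure => x /AF [k _ Fkx]; exists k.
apply: (le_trans (outer_measure_sigma_subadditive _ _)).
apply: lee_nneseries => [k _ _|k _]; first exact: outer_measure_ge0.
have [[a b] ->] := Fitv k; rewrite /=.
have [[c d]/= -> cd] := hg a b.
rewrite -[leLHS]/(@lebesgue_measure R `]c, d[) lebesgue_measure_itv.
rewrite wlength_itv/= !lte_fin -!EFinB cd.
have -> : (c < d) = (a < b) by rewrite -subr_gt0 cd subr_gt0.
by [].
Qed.

Lemma le_outer_measure_translate c A : (mu^* (+%R c @^-1` A) <= mu^* A)%E.
Proof.
apply: le_outer_measure_preimage => a b; exists (a - c, b - c) => /=; last by lra.
by apply/seteqP; split => x /=; rewrite !in_itv/= => /andP[? ?]; lra.
Qed.

Lemma le_outer_measure_reflect c A :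
  (mu^* ((fun x => (c - x)%R) @^-1` A) <= mu^* A)%E.
Proof.
apply: le_outer_measure_preimage => a b; exists (c - b, c - a) => /=; last by lra.
by apply/seteqP; split => x /=; rewrite !in_itv/= => /andP[? ?]; lra.
Qed.

Lemma outer_measure_reflect c A :
  mu^* ((fun x => c - x) @^-1` A) = mu^* A.
Proof.
apply/eqP; rewrite eq_le le_outer_measure_reflect/=.
have {1}<- : (fun x => c - x) @^-1` ((fun x => c - x) @^-1` A) = A.
  by rewrite -comp_preimage; apply/seteqP; split => x /=; rewrite subKr.
exact: le_outer_measure_reflect.
Qed.

Lemma lebesgue_measurable_preimage (g g' : R -> R) A :
  cancel g g' -> cancel g' g ->
  (forall B, mu^* (g @^-1` B) <= mu^* B)%E ->
  (forall B, mu^* (g' @^-1` B) <= mu^* B)%E ->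
  lebesgue_measurable A -> lebesgue_measurable (g @^-1` A).
Proof.
move=> gK g'K mug mug' mA; apply: le_caratheodory_measurable => X.
have := mug' X; apply: le_trans; rewrite [leRHS](mA (g' @^-1` X)).
apply: leeD.
  rewrite (_ : _ `&` _ = g @^-1` (g' @^-1` X `&` A)); first exact: mug.
  by apply/seteqP; split => x /=; rewrite gK.
rewrite (_ : _ `&` _ = g @^-1` (g' @^-1` X `&` ~` A)); first exact: mug.
by apply/seteqP; split => x /=; rewrite gK.
Qed.

Lemma lebesgue_measurable_translate c A :
  lebesgue_measurable A -> lebesgue_measurable (+%R c @^-1` A).
Proof.
apply: (@lebesgue_measurable_preimage _ (+%R (- c))) => [x|x|B|B];
  [lra|lra| |]; exact: le_outer_measure_translate.
Qed.

Lemma lebesgue_measurable_reflect c A :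
  lebesgue_measurable A -> lebesgue_measurable ((fun x => c - x) @^-1` A).
Proof.
apply: (@lebesgue_measurable_preimage _ (fun x => c - x)) => [x|x|B|B];
  [lra|lra| |]; exact: le_outer_measure_reflect.
Qed.

Lemma lebesgue_measurable_itv (i : interval R) : lebesgue_measurable [set` i].
Proof. by apply: sub_caratheodory; exact: measurable_itv. Qed.

End outer_measure_isometry.

(** * Continuity of translation in measure, for sets and for functions *)

Section translation_continuity.
Context (R : realType).
Implicit Types (A : set R) (a b e h : R).

(** Half of a symmetric difference suffices: the other half is a translate of this one taken at
    [- h]. *)
Definition translation_continuous A := forall e, 0 < e ->
  \forall h \near (0 : R), (mu^* (A `\` +%R h @^-1` A) <= e%:E)%E.

Lemma translation_continuous_oo a b : translation_continuous `]a, b[.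
Proof.
(* A point that leaves the interval under a shift shorter than [d] is within [d] of an endpoint; the
   two end windows have total length [4 * d]. *)
move=> e e0; pose d := e / 4; have d0 : 0 < d by rewrite /d; lra.
near=> h.
have hd : `|h| < d by near: h; apply: (@nbhs0_lt R R d d0).
move: hd; rewrite ltr_norml => /andP[hd1 hd2].
apply: (@le_trans _ _ (mu^* (`](a - d)%R, (a + d)%R[%classic `|`
    `](b - d)%R, (b + d)%R[%classic))).
  apply: le_outer_measure => x /=; rewrite !in_itv/= => -[/andP[ax xb]].
  move=> /negP; rewrite negb_and -!leNgt => /orP[|] ?; [left|right]; lra.
apply: (le_trans (outer_measureU2 _ _ _)).
have mud (c : R) : (mu^* `](c - d)%R, (c + d)%R[ <= (e / 2)%:E)%E.
  by rewrite outer_measure_oo ?lee_fin /d; lra.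
by rewrite [e in leRHS]splitr EFinD; apply: leeD; exact: mud.
Unshelve. all: by end_near. Qed.

(** Half of [e] pays for the tail of the convergent series, the other half for the finitely many
    remaining sets. *)
Lemma outer_measure_bigcup_translate (F : nat -> set R) e : 0 < e ->
  (forall k, translation_continuous (F k)) ->
  (\sum_(k <oo) mu^* (F k) < +oo)%E ->
  \forall h \near (0 : R),
    (mu^* (\bigcup_k (F k `\` +%R h @^-1` F k)) <= e%:E)%E.
Proof.
move=> e0 cF Foo.
have e2 : 0 < e / 2 by lra.
have [N hN] : exists N, (\sum_(N <= k <oo) mu^* (F k) <= (e / 2)%:E)%E.
  have /fine_cvgP[Nfin] :=
    nneseries_tail_cvg Foo (fun k _ => outer_measure_ge0 mu^* (F k)).
  move=> /cvgrPdist_le/(_ _ e2) H.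
  have [N _ /(_ N (leqnn _))[Nf]] := filterI Nfin H.
  rewrite /= sub0r normrN => HN; exists N.
  by rewrite -(fineK Nf) lee_fin (le_trans (ler_norm _)).
(* [N.+1] keeps the divisor nonzero when [N] is 0. *)
have e3 : 0 < e / 2 / N.+1%:R by rewrite divr_gt0.
near=> h; pose G k := F k `\` +%R h @^-1` F k.
apply: (@le_trans _ _ (mu^* (\big[setU/set0]_(k < N) G k
    `|` \bigcup_(k in ~` `I_N) F k))).
  apply: le_outer_measure => x [k _ xk].
  have [kN|kN] := ltnP k N.
    by left; rewrite -(bigcup_mkord N G); exists k.
  by right; exists k => /=; [rewrite ltnNge kN|case: xk].
apply: (le_trans (outer_measureU2 _ _ _)).
rewrite [e in leRHS]splitr EFinD; apply: leeD; last first.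
  exact: le_trans (outer_measure_sigma_subadditive_tail _ _ _) hN.
apply: (le_trans (outer_measure_subadditive _ G _)).
apply: (@le_trans _ _ (\sum_(k < N) (e / 2 / N.+1%:R)%:E)%E).
  apply: lee_sum => k _.
  suff : forall k : 'I_N, (mu^* (F k `\` +%R h @^-1` F k) <= (e / 2 / N.+1%:R)%:E)%E.
    exact.
  by near: h; apply: filter_forall => j; exact: cF.
rewrite sumEFin lee_fin sumr_const card_ord -[leLHS]mulr_natr mulrAC ler_pdivrMr//.
by rewrite ler_pM2l// ler_nat.
Unshelve. all: by end_near. Qed.

(** Cover [A] by open intervals of total length close to its measure. A point of [A] shifted out of
    [A] either leaves its interval or lands in the small excess of the cover over [A]. *)
Lemma translation_continuous_measurable A :
  lebesgue_measurable A -> (mu^* A < +oo)%E -> translation_continuous A.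
Proof.
move=> mA Aoo e e0; have e2 : 0 < e / 2 by lra.
have Afin : mu^* A \is a fin_num by rewrite ge0_fin_numE// outer_measure_ge0.
have [F [Fitv AF] FA] : exists2 F, open_itv_cover A F &
    (\sum_(k <oo) mu^* (F k) < mu^* A + (e / 2)%:E)%E.
  have := Afin; rewrite {1}outer_measure_open_itv_cover.
  move=> /lb_ereal_inf_adherent-/(_ _ e2)[_ [F AF <-]].
  rewrite -outer_measure_open_itv_cover => FA; exists F => //.
  rewrite (le_lt_trans _ FA)//; apply: lee_nneseries => [k _ _|k _].
    exact: outer_measure_ge0.
  have [[a b] ->] := AF.1 k.
  by rewrite /= -[leLHS]/(@lebesgue_measure R `]a, b[) lebesgue_measure_itv wlength_itv.
have UA : (mu^* (\bigcup_k F k `\` A) <= (e / 2)%:E)%E.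
  have := le_trans (outer_measure_sigma_subadditive mu^* F) (ltW FA).
  rewrite (mA (\bigcup_k F k)) (_ : \bigcup_k F k `&` A = A); last exact: setIidr.
  by rewrite leeD2lE.
near=> h.
have UAh := le_trans (le_outer_measure_translate h (\bigcup_k F k `\` A)) UA.
apply: (@le_trans _ _ (mu^* (\bigcup_k (F k `\` +%R h @^-1` F k) `|`
    +%R h @^-1` (\bigcup_k F k `\` A)))).
  apply: le_outer_measure => x [Ax Axh]; have [k _ Fkx] := AF _ Ax.
  have [Fkxh|Fkxh] := pselect (F k (h + x)); last by left; exists k.
  by right; split => //; exists k.
apply: (le_trans (outer_measureU2 _ _ _)).
rewrite [e in leRHS]splitr EFinD; apply: leeD => //.
near: h; apply: outer_measure_bigcup_translate => //.
  by move=> k; have [[a b] ->] := Fitv k; exact: translation_continuous_oo.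
by rewrite (lt_trans FA)// -(fineK Afin) -EFinD ltry.
Unshelve. all: by end_near. Qed.

End translation_continuity.

(** Rounding [f] down to multiples of [eps] cuts [J] into countably many disjoint measurable level
    sets, whose measures sum to that of [J]; the bound for unions then applies. *)
Lemma translation_continuous_in_measure (R : realType) (f : R -> R) (J : set R)
    (eps e : R) :
  lebesgue_measurable_fun f -> lebesgue_measurable J -> (mu^* J < +oo)%E ->
  0 < eps -> 0 < e ->
  \forall h \near (0 : R),
    (mu^* (J `&` [set y | (eps < `|f (h + y) - f y|)%R]) <= e%:E)%E.
Proof.
move=> mf mJ Joo eps0 e0.
(* If y and h + y lie in the same level set F k, then f (h + y) and f y are at
   distance less than eps. *)
pose lvl z : nat := pickle (Num.floor (z / eps)).
pose F k := J `&` f @^-1` [set z | lvl z = k].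
have mF k : lebesgue_measurable (F k).
  apply: measurableI => //; rewrite -[X in measurable X]setTI; apply: mf => //.
  have [[m mk]|nk] := pselect (exists m : int, pickle m = k).
    rewrite (_ : [set _ | _] = `[m%:~R * eps, (m + 1)%:~R * eps[%classic).
      exact: measurable_itv.
    apply/seteqP; split => z /=; rewrite in_itv/= -ler_pdivlMr// -ltr_pdivrMr//.
      rewrite /lvl -mk => /(pcan_inj pickleK) <-.
      exact: real_floor_itv (num_real _).
    by rewrite /lvl -mk => /floor_def ->.
  rewrite (_ : [set _ | _] = set0); first exact: measurable0.
  by apply/seteqP; split => z //= zk; apply: nk; exists (Num.floor (z / eps)).
have UF : \bigcup_k F k = J.
  by apply/seteqP; split => [x [k _ []]//|x Jx]; exists (lvl (f x)).
have tF : trivIset setT F by move=> i j _ _ [x [[_ <-] [_ <-]]].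
have Foo : (\sum_(k <oo) mu^* (F k) < +oo)%E.
  rewrite -[X in (X < _)%E](@measure_semi_bigcup _ _ _ (@completed_lebesgue_measure R))//.
    by rewrite UF.
  exact: bigcupT_measurable.
have cF k : translation_continuous (F k).
  apply: translation_continuous_measurable => //.
  by apply: le_lt_trans Joo; apply: le_outer_measure => x [].
have := outer_measure_bigcup_translate e0 cF Foo; apply: filterS => h.
apply: le_trans; apply: le_outer_measure => x [Jx]; rewrite /= => fx.
exists (lvl (f x)) => //; split => // -[_ /= /(pcan_inj pickleK) fl].
have /andP[] := real_floor_itv (num_real (f x / eps)).
have /andP[] := real_floor_itv (num_real (f (h + x) / eps)).
rewrite fl intrD mulr1z ler_pdivlMr// ltr_pdivrMr// ler_pdivlMr// ltr_pdivrMr// !mulrDl.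
by move: fx; rewrite lter_normr => /orP[] ? ? ? ? ?; clear Joo Foo; lra.
Qed.

(** * Countable bases and measurability of oscillation sets *)

Lemma second_countable_seq (X : topologicalType) :
  @second_countable X -> exists2 e : nat -> set X, (forall n, open (e n)) &
    forall x V, nbhs x V -> exists2 n, e n x & e n `<=` V.
Proof.
move=> [B /countable_injP[i iB] [Bo Bn]].
(* Indices outside the image of [i] get the empty set, which is open. *)
exists (fun n => xget set0 [set U | B U /\ i U = n]) => [n|x V /Bn[U [BU Ux] UV]].
  by case: xgetP => [_ _ [/Bo]//|_]; exact: open0.
exists (i U); rewrite (_ : xget _ _ = U)//; apply: xget_unique => // W [BW iWU];
  by apply: iB; rewrite ?inE.
Qed.

(** By continuity, the oscillation bound on [U] need only be checked at one sample point in each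
    nonempty basic set inside [U], which leaves a countable intersection. *)
Lemma lebesgue_measurable_osc (R : realType) (f : R -> R) (S : set R)
    (X : topologicalType) (v : X -> R) (e : nat -> set X) (U : set X) (eps : R) :
  lebesgue_measurable_fun f -> lebesgue_measurable S ->
  (forall s, S s -> continuous (fun t => f (s + v t))) ->
  (forall x V, nbhs x V -> exists2 n, e n x & e n `<=` V) -> open U ->
  lebesgue_measurable [set s | S s /\
    forall t t', U t -> U t' -> `|f (s + v t) - f (s + v t')| <= eps].
Proof.
move=> mf mS fc eb oU.
have [t0|noX] := pselect (inhabited X); last first.
  rewrite (_ : [set _ | _] = S)//; apply/seteqP; split => [s []//|s Ss].
  by split => // t; case: noX.
case: t0 => t0.
pose d n := v (xget t0 (e n)).
pose P := [set n | e n !=set0 /\ e n `<=` U].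
have dP n : P n -> exists2 t, U t & d n = v t.
  move=> [[t et] eU]; exists (xget t0 (e n)) => //.
  by apply: eU; apply: xgetPex; exists t.
rewrite (_ : [set _ | _] = S `&` \bigcap_(m in P) \bigcap_(n in P)
    [set s | `|f (s + d m) - f (s + d n)| <= eps]); last first.
  apply/seteqP; split => [s [Ss sU]|s [Ss sU]].
    by split=> // m /dP[t Ut ->] n /dP[t' Ut' ->]; exact: sU.
  split=> // t t' Ut Ut'; apply/ler_addgt0Pr => r r0.
  have approx u : U u -> exists2 n, P n & `|f (s + v u) - f (s + d n)| < r / 2.
    move=> Uu; have r2 : 0 < r / 2 by lra.
    have /eb[n enu en] : nbhs u (U `&` [set w | `|f (s + v u) - f (s + v w)| < r / 2]).
      apply: filterI; first exact: open_nbhs_nbhs.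
      by have /cvgrPdist_lt/(_ _ r2) := fc _ Ss u.
    exists n; first by split; [exists u|move=> w /en[]].
    by have [] := en _ (@xgetPex _ t0 _ (ex_intro _ u enu)).
  have [m Pm] := approx _ Ut; have [n Pn] := approx _ Ut'.
  have := sU m Pm n Pn; rewrite /= !ler_norml !ltr_norml.
  by move=> /andP[? ?] /andP[? ?] /andP[? ?]; lra.
apply: measurableI => //; apply: bigcap_measurableType => m _.
apply: bigcap_measurableType => n _.
have mfd c : measurable_fun [set: lebesgueTypeR R] (fun s => f (s + c) : R).
  move=> _ Y mY; rewrite setTI.
  have := lebesgue_measurable_translate c (mf measurableT Y mY).
  by rewrite setTI; congr lebesgue_measurable; apply/seteqP; split => s /=; rewrite addrC.
have := measurable_funB (mfd (d m)) (mfd (d n)) measurableT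
  (measurable_itv `[- eps, eps]).
rewrite setTI; congr measurable; apply/seteqP.
by split => s /=; rewrite in_itv/= ler_norml.
Qed.

(** * Density points *)

Lemma density_gt (R : realType) (F : R -> \bar R) :
  (F r / (2 * r)%:E)%E @[r --> 0^'+] --> 1%:E ->
  \forall r \near (0 : R)^'+, ((3 / 2 * r)%:E < F r)%E.
Proof.
(* Any fraction above one half would do: two such portions of a window must overlap. *)
move=> F1; have /F1 : nbhs (1%:E : \bar R) (fun u => ((3 / 4)%:E < u)%E).
  by apply: open_ereal_gt'; rewrite lte_fin; lra.
rewrite /= => F34; near=> r.
have r0 : 0 < r by near: r; exact: nbhs_right_gt.
have : ((3 / 4)%:E < F r / (2 * r)%:E)%E by near: r.
rewrite inver gt_eqF ?mulr_gt0// lte_pdivlMr ?mulr_gt0// -EFinM.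
by congr (_ < _)%E; congr EFin; lra.
Unshelve. all: by end_near. Qed.

(** Reflection carries the window around [a] to the one around [b]. If [T] met the reflected [S] in
    a null set there, measurability of [S] would let their outer measures add up to more than the
    window. *)
Lemma outer_measure_density_sum_gt0 (R : realType) (S T : set R) (a b : R) :
  lebesgue_measurable S -> LD S a -> OD T b ->
  exists r, (0 < mu^* (T `&` (fun t => (a + b - t)%R) @^-1` S `&`
                       `](b - r)%R, (b + r)%R[%classic))%E.
Proof.
move=> mS /density_gt Sa /density_gt Tb.
near (0 : R)^'+ => r; exists r.
have r0 : 0 < r by near: r; exact: nbhs_right_gt.
have Sar :
    ((3 / 2 * r)%:E < completed_lebesgue_measure (S `&` `](a - r)%R, (a + r)%R[))%E.
  by near: r.
have Tbr :
    ((3 / 2 * r)%:E < lebesgue_outer_measure (T `&` `](b - r)%R, (b + r)%R[))%E.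
  by near: r.
pose B := `](b - r)%R, (b + r)%R[%classic.
pose S' := (fun t => a + b - t) @^-1` (S `&` `](a - r)%R, (a + r)%R[).
have mS' : lebesgue_measurable S'.
  apply: lebesgue_measurable_reflect; apply: measurableI => //.
  exact: lebesgue_measurable_itv.
have S'B : S' `<=` B.
  by move=> x [_] /=; rewrite /B/= !in_itv/= => /andP[? ?]; lra.
have muS' : ((3 / 2 * r)%:E < mu^* S')%E by rewrite outer_measure_reflect.
have muB : (mu^* S' + mu^* (B `&` ~` S') = (2 * r)%:E)%E.
  transitivity (mu^* B); first by rewrite [RHS](mS' B) (setIidr S'B).
  by rewrite outer_measure_oo; [congr EFin; lra|lra].
rewrite ltNge; apply/negP => le0.
have : (mu^* (T `&` B) <= mu^* (B `&` ~` S'))%E.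
  rewrite (mS' (T `&` B)) -[leRHS]add0e; apply: leeD; last first.
    by apply: le_outer_measure => x [[]].
  apply: le_trans le0; apply: le_outer_measure => x [[Tx Bx] [Sx _]].
  by split.
move=> /(lt_le_trans Tbr)/(lteD muS'); rewrite muB -EFinD lte_fin; lra.
Unshelve. all: by end_near. Qed.

(** * Continuity at sums of density points *)

Theorem theorem1 (R : realType) (f : R -> R) (S T : set R)
    (mf : lebesgue_measurable_fun f) (mS : lebesgue_measurable S)
    (fST : shift_continuous S T f) :
  forall x : R, [set a + b | a in LD S & b in OD T] x -> {for x, continuous f}.
Proof.
move=> _ [a aS [b bT <-]]; have [r pos] := outer_measure_density_sum_gt0 mS aS bT.
have [tau [/second_countable_seq[e oe eb] fc]] := fST.
move: (a + b) pos => x0 pos.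
pose X : topologicalType := Topological.Pack tau.
pose v (t : X) : R := \val t.
pose B : set R := `](b - r)%R, (b + r)%R[%classic.
apply/cvgrPdist_le => eps eps0.
have eps3 : 0 < eps / 3 by lra.
pose E i := [set s | S s /\ forall t t', e i t -> e i t' ->
  `|f (s + v t) - f (s + v t')| <= eps / 3].
have mE i : lebesgue_measurable (E i).
  exact: (lebesgue_measurable_osc (e := e)).
pose A i := (fun t => x0 - t) @^-1` E i `&` B.
have mA i : lebesgue_measurable (A i).
  apply: measurableI; first exact: lebesgue_measurable_reflect.
  exact: lebesgue_measurable_itv.
have [i [c c0 ci]] : exists i, exists2 c : R, 0 < c &
    (c%:E < mu^* (v @` e i `&` A i))%E.
  (* If all these sets were null, so would be their union, which contains the set of positive outer
     measure by shift continuity. *)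
  apply: contrapT => noi; move: pos; apply/negP; rewrite -leNgt.
  apply: (@le_trans _ _ (mu^* (\bigcup_i (v @` e i `&` A i)))).
    apply: le_outer_measure => t [[Tt St] Bt].
    pose u : X := SigSub (mem_set Tt).
    have : nbhs u [set w | `|f (x0 - t + v u) - f (x0 - t + v w)| < eps / 3 / 2].
      have eps6 : 0 < eps / 3 / 2 by lra.
      by have /cvgrPdist_lt/(_ _ eps6) := fc _ St u.
    move=> /eb[i iu ei]; exists i => //; split; first by exists u.
    split=> //; split=> // w w' /ei + /ei; rewrite /= !ltr_norml ler_norml.
    by move=> /andP[? ?] /andP[? ?]; lra.
  apply: (le_trans (outer_measure_sigma_subadditive _ _)).
  rewrite eseries0// => i _ _; apply/eqP; rewrite eq_le outer_measure_ge0 andbT.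
  apply/lee_addgt0Pr => c c0; rewrite add0e leNgt; apply/negP => ci.
  by apply: noi; exists i, c.
have Aoo : (mu^* (A i) < +oo)%E.
  apply: (@le_lt_trans _ _ (mu^* B)); first by apply: le_outer_measure => t [].
  exact: outer_measure_oo_lty.
(* [J] contains [x0 - t + t'] for all [t] and [t'] within [r] of [b]. *)
pose J : set R := `](x0 - 2 * r)%R, (x0 + 2 * r)%R[%classic.
have Joo : (mu^* J < +oo)%E.
  exact: outer_measure_oo_lty.
pose bad h := J `&` [set y | eps / 3 < `|f (h + y) - f y|].
suff : \forall h \near (0 : R), `|f x0 - f (x0 + h)| <= eps.
  by move/(nbhs0P (fun x => `|f x0 - f x| <= eps) x0).
near=> h.
have pick W : (mu^* W <= c%:E)%E -> exists2 t, (v @` e i `&` A i) t & ~ W t.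
  move=> Wc; apply: contrapT => noW; move: ci; apply/negP; rewrite -leNgt.
  apply: le_trans Wc; apply: le_outer_measure => t At.
  by apply: contrapT => Wt; apply: noW; exists t.
(* The shift is by [- h] because [x0 - (- h + t)] is [x0 - t + h]: both [x0 - t] and [x0 - t + h]
   end up in [E i]. *)
have [t [[u eu ut] [Et Bt]] notW] : exists2 t, (v @` e i `&` A i) t &
    ~ (A i `\` +%R (- h) @^-1` A i) t.
  apply: pick; near: h.
  apply/(nearN 0 (fun h => (mu^* (A i `\` +%R h @^-1` A i) <= c%:E)%E)).
  by rewrite oppr0; exact: translation_continuous_measurable.
have [Eht _] : A i (- h + t) by apply: contrapT => nA; apply: notW.
(* Translating [bad h] by [x0 - t] does not increase its outer measure, so how small [h] must be
   does not depend on [t]. *)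
have [t' [[u' eu' ut'] [_ Bt']] notbad] : exists2 t', (v @` e i `&` A i) t' &
    ~ (+%R (x0 - t) @^-1` bad h) t'.
  apply: pick; apply: (le_trans (le_outer_measure_translate _ _)); near: h.
  apply: translation_continuous_in_measure => //.
  exact: lebesgue_measurable_itv.
have close : `|f (h + (x0 - t + t')) - f (x0 - t + t')| <= eps / 3.
  rewrite leNgt; apply/negP => far; apply: notbad; split => //=.
  by move: Bt Bt'; rewrite /J/B/= !in_itv/= => /andP[? ?] /andP[? ?]; lra.
have := Et.2 _ _ eu eu'; have := Eht.2 _ _ eu eu'.
rewrite ut ut' /= (_ : x0 - (- h + t) + t = x0 + h); last lra.
rewrite (_ : x0 - (- h + t) + t' = h + (x0 - t + t')); last lra.
rewrite (_ : x0 - t + t = x0); last lra.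
move: close; rewrite !ler_norml => /andP[? ?] /andP[? ?] /andP[? ?]; lra.
Unshelve. all: by end_near. Qed.
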